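(* Let $\Sigma=\{1,\ldots,m\}$. The monoid $\Sigma^*/\!\sim_2$ is isomorphic to the submonoid, generated by $\Sigma$, of the free nil-$2$ group $N_2(\Sigma)$.
   Context: $\Sigma^*$ is the free monoid of finite words over $\Sigma$. For words $u,x$, the binomial coefficient $\binom{u}{x}$ is the number of times $x$ appears as a (not necessarily contiguous) subsequence of $u$. Two words $u,v\in\Sigma^*$ are $2$-binomially equivalent, $u\sim_2 v$, if $\binom{u}{x}=\binom{v}{x}$ for all words $x$ of length at most $2$; $\Sigma^*/\!\sim_2$ is the quotient monoid, with the operation induced by concatenation. The commutator in a group is $[x,y]=x^{-1}y^{-1}xy$. A nil-$2$ group is a group in which all commutators are central. The free nil-$2$ group on $m$ generators is given by the presentation $N_2(\Sigma)=\langle \Sigma \mid [x,y]z=z[x,y]\ (x,y,z\in\Sigma)\rangle$. *)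

(* Defs.v *)
From HB Require Import structures.
From mathcomp Require Import all_boot.
From mathcomp Require Import boolp classical_sets.

Set Implicit Arguments.
Unset Strict Implicit.
Unset Printing Implicit Defensive.

Local Open Scope quotient_scope.

(* The free monoid on T is [seq T], with concatenation and the empty word. *)

Record congruence (T : Type) := Congruence {
  congr_rel : seq T -> seq T -> Prop;
  congr_refl : forall u, congr_rel u u;
  congr_sym : forall u v, congr_rel u v -> congr_rel v u;
  congr_trans : forall v u w, congr_rel u v -> congr_rel v w -> congr_rel u w;
  congr_cat : forall u u' v v',
    congr_rel u u' -> congr_rel v v' -> congr_rel (u ++ v) (u' ++ v')
}.

Section QuotientMonoid.
Variables (T : choiceType) (c : congruence T).

Definition congrb : rel (seq T) := fun u v => `[< congr_rel c u v >].

Lemma congrb_refl : reflexive congrb.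
Proof. by move=> u; apply/asboolP/congr_refl. Qed.

Lemma congrb_sym : symmetric congrb.
Proof. by move=> u v; apply/asboolP/asboolP => /congr_sym. Qed.

Lemma congrb_trans : transitive congrb.
Proof.
by move=> v u w /asboolP uv /asboolP vw; apply/asboolP/(congr_trans uv vw).
Qed.

Canonical congrb_equiv := EquivRel congrb congrb_refl congrb_sym congrb_trans.

Definition word_quotient : Type := {eq_quot congrb_equiv}.

HB.instance Definition _ := Choice.on word_quotient.
HB.instance Definition _ := EqQuotient.on word_quotient.

Definition class_of_word (u : seq T) : word_quotient := \pi_word_quotient u.

Definition wq_one : word_quotient := class_of_word [::].

Definition wq_mul (a b : word_quotient) : word_quotient :=
  class_of_word (repr a ++ repr b).

Lemma class_of_wordP u v :
  class_of_word u = class_of_word v <-> congr_rel c u v.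
Proof.
split=> [/(@eqmodP _ congrb_equiv)/asboolP // | uv].
by apply/(@eqmodP _ congrb_equiv)/asboolP.
Qed.

Lemma class_of_wordK (a : word_quotient) : class_of_word (repr a) = a.
Proof. exact: reprK. Qed.

Lemma class_of_word_cat u v :
  class_of_word (u ++ v) = wq_mul (class_of_word u) (class_of_word v).
Proof.
by apply/class_of_wordP/congr_cat; apply/class_of_wordP;
  rewrite class_of_wordK.
Qed.

Lemma wq_mulA : associative wq_mul.
Proof.
move=> a b d; rewrite -(class_of_wordK a) -(class_of_wordK b).
by rewrite -(class_of_wordK d) -!class_of_word_cat catA.
Qed.

Lemma wq_mul1 : left_id wq_one wq_mul.
Proof. by move=> a; rewrite -(class_of_wordK a) -class_of_word_cat. Qed.

Lemma wq_mulr1 : right_id wq_one wq_mul.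
Proof. by move=> a; rewrite -(class_of_wordK a) -class_of_word_cat cats0. Qed.

HB.instance Definition _ :=
  isMonoid.Build word_quotient wq_mulA wq_mul1 wq_mulr1.

End QuotientMonoid.

Section BinomialEquivalence.
Variable T : choiceType.
Implicit Types (u v x : seq T).

(* Occurrences are counted by sets of positions of u, encoded as bit masks. *)
Definition word_binom u x : nat :=
  #|[set s : (size u).-tuple bool | mask s u == x]|.

Definition binomial_equiv (k : nat) u v : Prop :=
  forall x, size x <= k -> word_binom u x = word_binom v x.

Lemma word_binom_nil x : word_binom [::] x = (x == [::]).
Proof.
rewrite /word_binom; case: eqP => [->|/eqP xN0].
  rewrite (_ : [set _ | _] = [set: 0.-tuple bool]) ?cardsT ?card_tuple //.
  by apply/setP=> s; rewrite !inE mask0 eqxx.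
apply: eq_card0 => s; rewrite !inE mask0 eq_sym.
exact: negbTE.
Qed.

Lemma word_binom_cons a u x :
  word_binom (a :: u) x =
  word_binom u x + (if x is b :: x' then (a == b) * word_binom u x' else 0).
Proof.
rewrite /word_binom -!sum1dep_card /=.
rewrite (reindex (fun p : bool * (size u).-tuple bool => [tuple of p.1 :: p.2]))
  /=; last first.
  exists (fun s : (size u).+1.-tuple bool => (thead s, [tuple of behead s])).
    by case=> b s _ /=; congr pair; apply: val_inj.
  by move=> s _; rewrite [RHS]tuple_eta.
rewrite -(pair_big_dep xpredT
  (fun b (s : (size u).-tuple bool) => mask (b :: s) (a :: u) == x)
  (fun _ _ => 1)) /= big_bool addnC; congr addn.
case: x => [|b x] /=; first by rewrite big_pred0.
case: (a =P b) => [->|/eqP/negbTE ab].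
  by rewrite mul1n -sum1dep_card; apply: eq_bigl => s; rewrite eqseq_cons eqxx.
by rewrite mul0n big_pred0 // => s; rewrite eqseq_cons ab.
Qed.

Lemma word_binom_cat u v x :
  word_binom (u ++ v) x =
  \sum_(i < (size x).+1) word_binom u (take i x) * word_binom v (drop i x).
Proof.
elim: u x => [|a u IHu] x.
  rewrite big_ord_recl /= take0 drop0 word_binom_nil eqxx mul1n big1 ?addn0 //.
  by case: x => [|b x] i _; [case: i | rewrite word_binom_nil].
rewrite cat_cons word_binom_cons IHu.
under [in RHS]eq_bigr => i _ do rewrite word_binom_cons mulnDl.
rewrite big_split /=; congr addn.
case: x => [|b x]; first by rewrite big_ord_recl big_ord0.
rewrite big_ord_recl /= mul0n add0n IHu big_distrr /=.
by apply: eq_bigr => i _; rewrite mulnA.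
Qed.

Lemma binomial_equiv_cat k u u' v v' :
  binomial_equiv k u u' -> binomial_equiv k v v' ->
  binomial_equiv k (u ++ v) (u' ++ v').
Proof.
move=> Eu Ev x xk; rewrite !word_binom_cat; apply: eq_bigr => i _.
rewrite Eu ?Ev // ?size_drop ?(leq_trans (leq_subr _ _)) //.
by rewrite size_take_min (leq_trans (geq_minr _ _)).
Qed.

Definition binomial_congruence (k : nat) : congruence T := {|
  congr_rel := binomial_equiv k;
  congr_refl := fun u x _ => erefl;
  congr_sym := fun u v uv x xk => esym (uv x xk);
  congr_trans := fun v u w uv vw x xk => etrans (uv x xk) (vw x xk);
  congr_cat := @binomial_equiv_cat k |}.

End BinomialEquivalence.

Definition binomial_monoid (k : nat) (T : choiceType) : monoidType :=
  word_quotient (binomial_congruence T k).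

Section Presentation.
Variable T : choiceType.

(* [(x, true)] is the generator x and [(x, false)] its formal inverse. *)
Definition group_word : Type := seq (T * bool).

Definition gw_gen (x : T) : group_word := [:: (x, true)].

Definition gw_inv (u : group_word) : group_word :=
  rev [seq (p.1, ~~ p.2) | p <- u].

Definition gw_comm (u v : group_word) : group_word :=
  gw_inv u ++ gw_inv v ++ u ++ v.

Inductive pres_rel (R : group_word -> group_word -> Prop) :
    group_word -> group_word -> Prop :=
| pres_refl u : pres_rel R u u
| pres_sym u v : pres_rel R u v -> pres_rel R v u
| pres_trans v u w : pres_rel R u v -> pres_rel R v w -> pres_rel R u w
| pres_cat u u' v v' :
    pres_rel R u u' -> pres_rel R v v' -> pres_rel R (u ++ v) (u' ++ v')
| pres_cancel x b : pres_rel R [:: (x, b); (x, ~~ b)] [::]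
| pres_relator u v : R u v -> pres_rel R u v.

Variable R : group_word -> group_word -> Prop.
Local Open Scope group_scope.

Definition pres_congruence : congruence (T * bool) := {|
  congr_rel := pres_rel R;
  congr_refl := pres_refl R;
  congr_sym := @pres_sym R;
  congr_trans := @pres_trans R;
  congr_cat := @pres_cat R |}.

Definition presented_group : Type := word_quotient pres_congruence.

HB.instance Definition _ := Monoid.on presented_group.

Definition pg_inv (a : presented_group) : presented_group :=
  class_of_word pres_congruence (gw_inv (repr a)).

Lemma gw_inv_cons p u : gw_inv (p :: u) = gw_inv u ++ [:: (p.1, ~~ p.2)].
Proof. by rewrite /gw_inv /= rev_cons -cats1. Qed.

Lemma gw_invK : involutive gw_inv.
Proof.
move=> u; rewrite /gw_inv map_rev revK -map_comp -[RHS]map_id.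
by apply: eq_map => -[x b] /=; rewrite negbK.
Qed.

Lemma pres_mulgV u : pres_rel R (u ++ gw_inv u) [::].
Proof.
elim: u => [|[x b] u IHu]; first exact: pres_refl.
rewrite gw_inv_cons /= catA.
apply: pres_trans (pres_cancel R x b).
exact: (pres_cat (pres_refl R [:: (x, b)])
  (pres_cat IHu (pres_refl R [:: (x, ~~ b)]))).
Qed.

Lemma pres_mulVg u : pres_rel R (gw_inv u ++ u) [::].
Proof. by rewrite -{2}(gw_invK u); apply: pres_mulgV. Qed.

Lemma pg_mulVg (a : presented_group) : pg_inv a * a = 1.
Proof.
rewrite -[X in _ * X]class_of_wordK -[LHS]class_of_word_cat.
exact/class_of_wordP/pres_mulVg.
Qed.

Lemma pg_mulgV (a : presented_group) : a * pg_inv a = 1.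
Proof.
rewrite -[X in X * _]class_of_wordK -[LHS]class_of_word_cat.
exact/class_of_wordP/pres_mulgV.
Qed.

HB.instance Definition _ := hasInv.Build presented_group pg_inv.
HB.instance Definition _ := Monoid_isGroup.Build presented_group pg_mulVg pg_mulgV.

Definition pg_gen (x : T) : presented_group :=
  class_of_word pres_congruence (gw_gen x).

End Presentation.

Inductive nil2_relation (T : choiceType) : group_word T -> group_word T -> Prop :=
| Nil2Relation (x y z : T) :
    nil2_relation (gw_comm (gw_gen x) (gw_gen y) ++ gw_gen z)
                  (gw_gen z ++ gw_comm (gw_gen x) (gw_gen y)).

Definition free_nil2_group (T : choiceType) : groupType :=
  presented_group (@nil2_relation T).

Definition nil2_gen (T : choiceType) : T -> free_nil2_group T :=
  pg_gen (@nil2_relation T).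

Section GeneratedSubmonoid.
Variables (M : monoidType) (A : set M).

(* Intersection of all the submonoids of M that contain A. *)
Definition submonoid_gen : {pred M} := fun x =>
  `[< forall S : {pred M}, monoid_closed S -> (forall a, A a -> a \in S) ->
      x \in S >].

Lemma submonoid_gen_closed : monoid_closed submonoid_gen.
Proof.
split=> [|x y /asboolP Hx /asboolP Hy]; apply/asboolP => S Scl AS.
  by case: Scl.
by case: (Scl) => _ SM; apply: SM; [apply: Hx | apply: Hy].
Qed.

Definition generated_submonoid : Type := {x : M | x \in submonoid_gen}.

HB.instance Definition _ := SubChoice.on generated_submonoid.
HB.instance Definition _ := SubChoice_isSubMonoid.Build M _ generated_submonoid
  submonoid_gen_closed.

End GeneratedSubmonoid.

(* Main.v *)
(* The product in N_2 of a word [w] can be rearranged into the normal form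
   [prod_x x^(w choose x) * prod_(x before y) [y, x]^(w choose yx)], since
   moving a letter [a] leftwards past [x] creates the central factor [a, x].
   Hence 2-binomially equivalent words have the same product.  Conversely the
   coefficients of [x] and [xy] extend to words over letters and inverse letters
   as integer invariants of the presentation of N_2. *)
Require Import Defs.
From mathcomp Require Import all_boot.
From mathcomp Require Import boolp classical_sets.
From mathcomp Require Import ssralg ssrint ring.

Set Implicit Arguments.
Unset Strict Implicit.
Unset Printing Implicit Defensive.

(** * Normal form of products in a group where commutators of generators are central *)

Section NormalForm.
Local Open Scope group_scope.
Variables (T : choiceType) (G : groupType) (g : T -> G).
Hypothesis g_nil2 : forall x y z, commute [~ g x, g y] (g z).
Implicit Types (a x y : T) (w u v : seq T) (s : seq T).

Definition word_prod w : G := \prod_(x <- w) g x.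

Lemma word_prod_cat u v : word_prod (u ++ v) = word_prod u * word_prod v.
Proof. exact: big_cat. Qed.

(** Commuting with the letters is enough: only products of letters and their inverses are met
    below. *)
Definition central (c : G) := forall x, commute c (g x).

Lemma centralX c n : central c -> central (c ^+ n).
Proof. by move=> cC x; apply/commute_sym/commuteX/commute_sym. Qed.

Lemma central_commX c x y n : central c -> commute c ([~ g x, g y] ^+ n).
Proof.
move=> cC; apply/commuteX; rewrite commgEl conjgE.
by do !apply/commuteM; rewrite -?mulgA; do ?apply/commuteM;
   do ?apply/commuteV.
Qed.

(** By [y x = x y [y, x]], bringing the letters [x] in front of [y] costs one commutator per
    occurrence of [yx]. *)
Definition comm_part x s w : G :=
  \prod_(y <- s) [~ g y, g x] ^+ word_binom w [:: y; x].

(** The list [s] supplies the order of the letters, since [T] carries none. *)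
Fixpoint normal_form s w : G :=
  if s is x :: s' then
    g x ^+ word_binom w [:: x] * normal_form s' w * comm_part x s' w
  else 1.

Lemma word_binom_empty w : word_binom w [::] = 1%N.
Proof.
by elim: w => [|a w IHw]; rewrite ?word_binom_nil // word_binom_cons addn0.
Qed.

Lemma word_binom_cons1 a w x :
  word_binom (a :: w) [:: x] = word_binom w [:: x] + (a == x).
Proof. by rewrite word_binom_cons word_binom_empty muln1. Qed.

Lemma word_binom_cons2 a w x y :
  word_binom (a :: w) [:: x; y] =
  word_binom w [:: x; y] + (a == x) * word_binom w [:: y].
Proof. exact: word_binom_cons. Qed.

Lemma comm_part_cons_notin a x s w :
  a \notin s -> comm_part x s (a :: w) = comm_part x s w.
Proof.
move=> aNs; apply: eq_big_seq => y ys; rewrite word_binom_cons2.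
case: eqP => [ay|_]; first by rewrite ay ys in aNs.
by rewrite mul0n addn0.
Qed.

(** The new first letter [a] precedes every [x] of [w], and centrality brings the extra factor to
    the front. *)
Lemma comm_part_cons_in a x s w : uniq s -> a \in s ->
  comm_part x s (a :: w) =
  [~ g a, g x] ^+ word_binom w [:: x] * comm_part x s w.
Proof.
elim: s => //= y s IHs /andP[yNs s_uniq]; rewrite inE.
rewrite /comm_part !big_cons -!/(comm_part _ _ _) word_binom_cons2.
case: (eqVneq a y) => [-> _|ay /= a_s].
  by rewrite mul1n addnC expgnDr -mulgA comm_part_cons_notin.
rewrite mul0n addn0 IHs // !mulgA; congr (_ * _).
by apply/central_commX/centralX.
Qed.

Lemma normal_form_cons_notin a s w :
  a \notin s -> normal_form s (a :: w) = normal_form s w.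
Proof.
elim: s => //= x s IHs; rewrite inE negb_or => /andP[ax aNs].
by rewrite IHs // comm_part_cons_notin // word_binom_cons1 (negbTE ax) addn0.
Qed.

Lemma central_comm_normal_form x y n s w :
  commute ([~ g x, g y] ^+ n) (normal_form s w).
Proof.
have cC : central ([~ g x, g y] ^+ n) by apply: centralX.
elim: s => [|z s IHs] /=; first exact: commute1.
apply: commuteM; first by apply: commuteM => //; apply: commuteX.
by apply: commute_prod => t _; apply: central_commX.
Qed.

(** Here [g a] travels right to its own block; each block [g x ^+ n] crossed on the way leaves
    exactly the factor given by [comm_part_cons_in]. *)
Lemma normal_form_cons_in a s w :
  uniq s -> a \in s -> normal_form s (a :: w) = g a * normal_form s w.
Proof.
elim: s => //= x s IHs /andP[xNs s_uniq]; rewrite inE word_binom_cons1.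
case: (eqVneq a x) => [-> _|ax /= a_s].
  rewrite normal_form_cons_notin // comm_part_cons_notin // addn1.
  by rewrite expgS !mulgA.
set n := word_binom w [:: x].
have swap : g a * g x ^+ n = g x ^+ n * g a * [~ g a, g x] ^+ n.
  elim: n => [|n IHn]; first by rewrite !mulg1 mul1g.
  rewrite expgS mulgA [g a * g x]commgC -mulgA commuteX //.
  by rewrite -mulgA (mulgA (g a)) IHn [in RHS]expgSr !mulgA.
rewrite addn0 IHs // comm_part_cons_in // !mulgA swap.
rewrite -/n -!mulgA; do 2!congr (_ * _); rewrite !mulgA; congr (_ * _).
exact/commute_sym/central_comm_normal_form.
Qed.

Lemma word_prod_normal_form s w :
  uniq s -> {subset w <= s} -> word_prod w = normal_form s w.
Proof.
move=> s_uniq; elim: w => [_|a w IHw ws].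
  rewrite /word_prod big_nil; elim: s {s_uniq} => //= x s <-.
  rewrite word_binom_nil mulg1 mul1g /comm_part.
  by rewrite big1_seq // => y _; rewrite word_binom_nil.
rewrite /word_prod big_cons -/(word_prod w) IHw; last first.
  by move=> x xw; apply: ws; rewrite inE xw orbT.
by rewrite normal_form_cons_in // ws // mem_head.
Qed.

Lemma binomial_equiv2_word_prod u v :
  binomial_equiv 2 u v -> word_prod u = word_prod v.
Proof.
(* One list covers both words, so that their normal forms use the same order. *)
move=> uv; pose s := undup (u ++ v).
have us : {subset u <= s} by move=> x xu; rewrite mem_undup mem_cat xu.
have vs : {subset v <= s} by move=> x xv; rewrite mem_undup mem_cat xv orbT.
rewrite !(@word_prod_normal_form s) ?undup_uniq //.
elim: s {us vs} => //= x s ->; rewrite uv //; congr (_ * _).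
by apply: eq_bigr => y _; rewrite uv.
Qed.

End NormalForm.

(** * Integer invariants of words over letters and inverse letters *)

Section Invariants.
Local Open Scope ring_scope.
Import GRing.Theory.
Variable T : choiceType.
Implicit Types (x y : T) (u v : group_word T).

Definition letter_sign (b : bool) : int := if b then 1 else -1.

Fixpoint signed_count x u : int :=
  if u is p :: u' then (p.1 == x)%:R * letter_sign p.2 + signed_count x u'
  else 0.

(* The correction [(z == x) * (z == y)] at an inverse letter [z^-1] makes
   [z z^-1] count zero. *)
Fixpoint signed_pairs x y u : int :=
  if u is p :: u' then
    (p.1 == x)%:R * (letter_sign p.2 * signed_count y u'
                     + (~~ p.2)%:R * (p.1 == y)%:R)
    + signed_pairs x y u'
  else 0.

Lemma signed_count_cat x u v :
  signed_count x (u ++ v) = signed_count x u + signed_count x v.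
Proof. by elim: u => [|p u IHu] /=; rewrite ?add0r // IHu addrA. Qed.

(** This is the product rule for the coefficient of [XY] in the Magnus expansion, which sends [z] to
    [1 + Z] and its inverse to [1 - Z + Z^2 - ...]. *)
Lemma signed_pairs_cat x y u v :
  signed_pairs x y (u ++ v) =
  signed_pairs x y u + signed_pairs x y v + signed_count x u * signed_count y v.
Proof.
elim: u => [|p u IHu] /=; first by ring.
by rewrite IHu signed_count_cat; ring.
Qed.

(** Both invariants go through one induction, because the product rule for pairs involves counts. *)
Lemma pres_rel_nil2_signed u v : pres_rel (@nil2_relation T) u v ->
  forall x y, signed_count x u = signed_count x v /\
              signed_pairs x y u = signed_pairs x y v.
Proof.
elim=> {u v}
  [//|u v _ IH x y|v u w _ IH1 _ IH2 x y|u u' v v' _ IH1 _ IH2 x y|z b x y|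
   _ _ [x' y' z] x y].
- by have [-> ->] := IH x y.
- by have [-> ->] := IH1 x y.
(* The cross term needs the count of [y] in the right factor, hence the second use of [IH2]. *)
- have [cu pu] := IH1 x y; have [cv pv] := IH2 x y; have [cv' _] := IH2 y y.
  by rewrite !signed_pairs_cat !signed_count_cat cu cv cv' pu pv.
- by case: b => /=; rewrite /letter_sign; split; ring.
- set c := gw_comm _ _.
  (* A commutator has all counts zero, so the cross terms vanish and the order of the factors is
     invisible. *)
  have c0 t : signed_count t c = 0 by rewrite /= /letter_sign; ring.
  move: c c0 => c c0.
  by rewrite !signed_pairs_cat !signed_count_cat !c0; split; ring.
Qed.

Definition pos_word (w : seq T) : group_word T := [seq (x, true) | x <- w].

Lemma signed_count_pos x w :
  signed_count x (pos_word w) = (word_binom w [:: x])%:Z.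
Proof.
elim: w => [|a w IHw] /=; first by rewrite word_binom_nil.
by rewrite IHw word_binom_cons1 /letter_sign mulr1 PoszD addrC natz.
Qed.

Lemma signed_pairs_pos x y w :
  signed_pairs x y (pos_word w) = (word_binom w [:: x; y])%:Z.
Proof.
elim: w => [|a w IHw] /=; first by rewrite word_binom_nil.
rewrite IHw signed_count_pos word_binom_cons2 /letter_sign PoszD PoszM natz.
ring.
Qed.

Lemma pres_rel_nil2_binomial_equiv (u v : seq T) :
  pres_rel (@nil2_relation T) (pos_word u) (pos_word v) -> binomial_equiv 2 u v.
Proof.
move=> /pres_rel_nil2_signed uv [|x [|y []]] // _.
- by rewrite !word_binom_empty.
- by have [] := uv x x; rewrite !signed_count_pos => -[].
- by have [_] := uv x y; rewrite !signed_pairs_pos => -[].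
Qed.

End Invariants.

(** * Positive words in the free nil-2 group *)

Section Embedding.
Local Open Scope group_scope.
Variable T : choiceType.

Lemma nil2_gen_comm (x y z : T) :
  commute [~ nil2_gen x, nil2_gen y] (nil2_gen z).
Proof.
(* Inverses are defined through [repr], so this one is identified by cancelling [nil2_gen a]. *)
have invE (a : T) : (nil2_gen a)^-1 =
    class_of_word (pres_congruence (@nil2_relation T)) (gw_inv (gw_gen a)).
  apply: (mulgI (nil2_gen a)); rewrite mulgV -[RHS]class_of_word_cat.
  by apply/esym/class_of_wordP/pres_mulgV.
have commE : [~ nil2_gen x, nil2_gen y] =
    class_of_word (pres_congruence (@nil2_relation T))
      (gw_comm (gw_gen x) (gw_gen y)).
  by rewrite commgEl conjgE !invE /gw_comm !class_of_word_cat.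
rewrite commE /commute -[LHS]class_of_word_cat -[RHS]class_of_word_cat.
by apply/class_of_wordP/pres_relator/Nil2Relation.
Qed.

Lemma word_prod_nil2_gen (w : seq T) :
  word_prod (@nil2_gen T) w =
  class_of_word (pres_congruence (@nil2_relation T)) (pos_word w).
Proof.
elim: w => [|a w IHw]; first exact: big_nil.
by rewrite /word_prod big_cons -/(word_prod _ w) IHw -[LHS]class_of_word_cat.
Qed.

(** One direction makes the product well defined on binomial classes, the other makes it injective
    there. *)
Lemma word_prod_nil2P (u v : seq T) :
  word_prod (@nil2_gen T) u = word_prod (@nil2_gen T) v <->
  binomial_equiv 2 u v.
Proof.
split; last by apply/binomial_equiv2_word_prod/nil2_gen_comm.
rewrite !word_prod_nil2_gen => /class_of_wordP.
exact: pres_rel_nil2_binomial_equiv.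
Qed.

End Embedding.

(** * The generated submonoid and the isomorphism *)

(** The products form a submonoid containing the generators, and every such submonoid contains all
    products. *)
Lemma submonoid_gen_rangeP (T : choiceType) (G : groupType) (g : T -> G)
    (a : G) :
  reflect (exists w, a = word_prod g w) (a \in submonoid_gen (range g)).
Proof.
apply: (iffP idP) => [/asboolP gen_a|[w ->]].
  pose S : {pred G} := fun b => `[< exists w, b = word_prod g w >].
  apply/asboolP; apply: (gen_a S) => [|_ [x _ <-]].
    split=> [|_ _ /asboolP[u ->] /asboolP[v ->]]; apply/asboolP.
      by exists [::]; rewrite /word_prod big_nil.
    by exists (u ++ v); rewrite word_prod_cat.
  by apply/asboolP; exists [:: x]; rewrite /word_prod big_seq1.
apply/asboolP => S [S1 SM] gS; rewrite /word_prod.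
by apply: (big_ind (fun b => b \in S)) => // x _; apply: gS; exists x.
Qed.

Theorem theorem11 (m : nat) :
  exists f : binomial_monoid 2 'I_m ->
             generated_submonoid (range (@nil2_gen 'I_m)),
    monoid_morphism f /\ bijective f.
Proof.
pose g := @nil2_gen 'I_m.
pose cls := class_of_word (binomial_congruence 'I_m 2).
have prod_gen w : word_prod g w \in submonoid_gen (range g).
  by apply/submonoid_gen_rangeP; exists w.
pose f (a : binomial_monoid 2 'I_m) : generated_submonoid (range g) :=
  exist _ (word_prod g (repr a)) (prod_gen (repr a)).
have fE w : val (f (cls w)) = word_prod g w.
  apply/word_prod_nil2P/(class_of_wordP (binomial_congruence 'I_m 2)).
  exact: class_of_wordK.
exists f; split.
  split=> [|a b]; apply: val_inj.
    (* The unit and products of the quotient are by definition classes of words, so [fE] applies. *)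
    by rewrite [LHS](fE [::]) /word_prod big_nil.
  by rewrite [LHS]fE word_prod_cat.
have surj (y : generated_submonoid (range g)) :
    exists w, val y = word_prod g w.
  by apply/submonoid_gen_rangeP; apply: (valP y).
(* The inverse chooses some word with product [y]; its class does not depend on the choice. *)
exists (fun y => cls (projT1 (cid (surj y)))) => [a|y].
  case: cid => w /= aw; rewrite -[RHS]class_of_wordK.
  by apply/class_of_wordP/word_prod_nil2P; rewrite -aw.
by apply: val_inj; rewrite fE; case: cid.
Qed.
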